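(* Let $\epsilon\le 1/10$ and let $\delta<1$ be any positive constant. Suppose each of the $n$ nodes starts with an input value chosen by a late $\epsilon$-bounded adaptive blocking adversary from a domain of size polynomial in $n$. Then there is a distributed algorithm that, against this adversary, terminates in $O(\log n)$ rounds and sends $O(n\log n)$ messages in total, and with high probability at least $(1-\epsilon/\delta)n$ nodes decide on the same value, and if all nodes start with the same input value $x$ then $x$ is the only possible decision.
   Context: Model: $n$ anonymous nodes, every pair of which can communicate directly, operate in synchronous rounds; in each round every node first receives all messages sent to it in the previous round that were not blocked, then performs arbitrary local computation, then sends messages. A late $\epsilon$-bounded adaptive adversary (with unlimited computational power): at the start of each round $t\ge 2$ it observes the complete state of the system at the beginning of round $t-1$, and based on this chooses a set of at most $\epsilon n$ nodes to block in round $t$; a blocked node can neither send nor receive messages in that round. In round 1 the adversary knows the initial state but not the random choices of the nodes in that round. ''With high probability'' means with probability at least $1-n^{-\Omega(1)}$. *)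

(* Defs.v *)
From Stdlib Require Import Reals.
From mathcomp Require Import all_boot.

(* A (randomized, anonymous) distributed algorithm for n nodes whose inputs  *)
(* come from the domain 'I_m.  All nodes run the same code and have no       *)
(* identifier.  A node reaches the other n-1 nodes through its ports         *)
(* 'I_n.-1 (the port numbering is chosen adversarially, see [valid_ports]).  *)
(* In every round a node draws a fresh uniformly random coin from the finite *)
(* type Coin, and from its state, the messages received (indexed by the      *)
(* port they arrived on) and the coin computes a new state and the messages  *)
(* to send on each port.  After [rounds] rounds every node outputs           *)
(* [output st] : None = no decision, Some y = decides y.                     *)
Record algo (n m : nat) := Algo {
  St : Type;
  Msg : Type;
  Coin : finType;
  coin0 : Coin;
  rounds : nat;
  init : 'I_m -> St;
  step : St -> ('I_n.-1 -> seq Msg) -> Coin -> St * ('I_n.-1 -> seq Msg);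
  output : St -> option 'I_m
}.
Arguments St {n m}.
Arguments Msg {n m}.
Arguments Coin {n m}.
Arguments coin0 {n m}.
Arguments rounds {n m}.
Arguments init {n m}.
Arguments step {n m}.
Arguments output {n m}.

Section Exec.
Variables (n m : nat) (A : algo n m).

(* Complete state of the system at the beginning of a round: the local      *)
(* states, and the messages sent in the previous round (by sender and       *)
(* sender port; messages of a sender blocked in that round are absent).     *)
Record config := Config {
  cst : 'I_n -> St A;
  cout : 'I_n -> 'I_n.-1 -> seq (Msg A)
}.

(* port u p = the node reached by node u through its port p. *)
Definition ports := 'I_n -> 'I_n.-1 -> 'I_n.

Definition valid_ports (port : ports) : Prop :=
  forall u, injective (port u) /\ forall p, port u p != u.

(* A late adaptive adversary: the set of nodes it blocks in round r          *)
(* (rounds numbered from 0) is a function of the history of complete         *)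
(* configurations it has observed (see [configs] below: at round r >= 1 it   *)
(* has seen the configurations at the beginning of rounds 0..r-1, and at     *)
(* round 0 it has seen the initial configuration).  Its computational power  *)
(* is unlimited (arbitrary functions).                                       *)
Definition adversary := nat -> seq config -> {set 'I_n}.

Definition eps_bounded (eps : R) (adv : adversary) : Prop :=
  forall r h, Rle (INR #|adv r h|) (Rmult eps (INR n)).

Definition coin_space := {ffun 'I_(rounds A) -> {ffun 'I_n -> Coin A}}.

Variables (port : ports) (inp : 'I_n -> 'I_m) (adv : adversary).

Definition init_config : config :=
  Config (fun v => init A (inp v)) (fun _ _ => [::]).

Definition inbox (c : config) (B : {set 'I_n}) (v : 'I_n)
  : 'I_n.-1 -> seq (Msg A) :=
  fun q => if v \in B then [::] else
    let u := port v q in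
    match [pick p | port u p == v] with
    | Some p => cout c u p
    | None => [::]
    end.

Definition round (c : config) (B : {set 'I_n}) (w : 'I_n -> Coin A) : config :=
  Config (fun v => (step A (cst c v) (inbox c B v) (w v)).1)
         (fun v p => if v \in B then [::]
                     else (step A (cst c v) (inbox c B v) (w v)).2 p).

Definition coin_at (w : coin_space) (r : nat) (v : 'I_n) : Coin A :=
  match (insub r : option 'I_(rounds A)) with
  | Some i => w i v
  | None => coin0 A
  end.

(* configs w r = [c_0; ...; c_r], c_k the configuration at the beginning of  *)
(* round k (0-indexed).  The blocked set of round r is chosen by the         *)
(* adversary from [c_0; ...; c_(max 0 (r-1))]. *)
Fixpoint configs (w : coin_space) (r : nat) : seq config :=
  match r with
  | 0 => [:: init_config]
  | r'.+1 =>
      let h := configs w r' in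
      rcons h (round (last init_config h) (adv r' (take (maxn 1 r') h))
                     (coin_at w r'))
  end.

Definition final (w : coin_space) : config :=
  last init_config (configs w (rounds A)).

Definition decision (w : coin_space) (v : 'I_n) : option 'I_m :=
  output A (cst (final w) v).

(* number of messages sent (by non-blocked senders) in the previous round *)
Definition msgs_in (c : config) : nat :=
  \sum_(v < n) \sum_(p < n.-1) size (cout c v p).

Definition total_msgs (w : coin_space) : nat :=
  \sum_(c <- configs w (rounds A)) msgs_in c.

Definition max_agree (w : coin_space) : nat :=
  \max_(y < m) #|[set v | decision w v == Some y]|.

End Exec.
Arguments valid_ports {n}.
Arguments cst {n m A}.
Arguments cout {n m A}.
Arguments adversary {n m} A.
Arguments eps_bounded {n m A}.
Arguments coin_space {n m} A.
Arguments init_config {n m A}.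
Arguments inbox {n m A}.
Arguments round {n m A}.
Arguments coin_at {n m A}.
Arguments configs {n m A}.
Arguments final {n m A}.
Arguments decision {n m A}.
Arguments msgs_in {n m A}.
Arguments total_msgs {n m A}.
Arguments max_agree {n m A}.

Definition prob (T : finType) (P : pred T) : R :=
  Rdiv (INR #|[set w | P w]|) (INR #|{: T}|).

Definition Rleb (x y : R) : bool := if Rle_dec x y then true else false.

(* Main.v *)
Require Import Defs.
From Stdlib Require Import Reals Lra.
From mathcomp Require Import all_boot zify.

(* Every node pushes its input to O(log n) random ports; then, for log n rounds,
   every node pushes the least value it has just received to five random ports,
   and a last burst of O(log n) messages per node ends the algorithm.  The
   blocked set of the first round is fixed by the initial state, so the least
   input among the other nodes is a fixed value that is never undercut later.
   The nodes that receive it in a round are not blocked in that round, hence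
   they forward it, and the set blocked when their messages arrive does not
   depend on the ports they draw.  So the number of its fresh receivers doubles
   until it is a constant fraction of n, and the last burst reaches every node
   that is not blocked at the end.  Each step fails for at most a fraction 1/n
   of the coins, as one sees by redrawing one coin at a time. *)

Set Implicit Arguments.
Unset Strict Implicit.
Unset Printing Implicit Defensive.

Local Delimit Scope R_scope with R.

Lemma card_set_sum (T : finType) (P : pred T) :
  #|[set x | P x]| = \sum_x P x.
Proof.
by rewrite -sum1dep_card big_mkcond; apply: eq_bigr => x _; case: (P x).
Qed.

Lemma card_set_ord_lt n k : #|[set i : 'I_n | i < k]| = minn k n.
Proof.
rewrite -sum1dep_card; have [kn|nk] := leqP k n.
  by rewrite -(big_ord_widen n (fun=> 1)) // sum1_card card_ord.
rewrite (eq_bigl predT) ?sum1_card ?card_ord // => i.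
exact: ltn_trans (ltn_ord i) nk.
Qed.

Section Frequency.
Variable T : finType.
Implicit Types (a b : nat) (P Q : pred T).

(* A uniformly random [x] satisfies [P] with probability at most [a / b]. *)
Definition freq_leq a b P := b * #|[set x | P x]| <= a * #|T|.

Lemma sub_freq_leq a b P Q : subpred P Q -> freq_leq a b Q -> freq_leq a b P.
Proof.
move=> PQ; apply: leq_trans; rewrite leq_mul2l; apply/orP; right.
by apply/subset_leq_card/subsetP => x; rewrite !inE => /PQ.
Qed.

Lemma freq_leq_ratio a b a' b' P :
  0 < b -> a * b' <= a' * b -> freq_leq a b P -> freq_leq a' b' P.
Proof.
rewrite /freq_leq => b_gt0 ratio_le P_le; rewrite -(leq_pmul2l b_gt0) mulnCA.
apply: leq_trans (leq_mul (leqnn b') P_le) _.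
by rewrite !mulnA leq_mul2r mulnC [b * _]mulnC ratio_le orbT.
Qed.

Lemma freq_leq_andl (c : bool) a b P :
  (c -> freq_leq a b P) -> freq_leq a b (fun x => c && P x).
Proof.
case: c => [|_]; first exact.
by rewrite /freq_leq card_set_sum big1 ?muln0.
Qed.

Lemma freq_leq_exists (I : finType) (P : I -> pred T) a b :
  (forall i, freq_leq a b (P i)) ->
  freq_leq (#|I| * a) b (fun x => [exists i, P i x]).
Proof.
move=> P_le; apply: (@leq_trans (b * \sum_i #|[set x | P i x]|)).
  rewrite leq_mul2l; under eq_bigr do rewrite card_set_sum.
  rewrite card_set_sum exchange_big; apply/orP; right; apply: leq_sum => x _.
  by case: existsP => // -[i Pix]; rewrite (bigD1 i) //= Pix.
rewrite big_distrr -mulnA -sum_nat_const; apply: leq_sum => i _; exact: P_le.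
Qed.

End Frequency.

Lemma leq_geometric_set (I : finType) (D : {set I}) (F : {set I} -> nat) a b :
  (forall i (S : {set I}), i \in D -> i \notin S ->
     b * F (i |: S) <= a * F S) ->
  forall S : {set I}, S \subset D -> b ^ #|S| * F S <= a ^ #|S| * F set0.
Proof.
move=> F_le S; have [k] := ubnP #|S|; elim: k => // k IH in S *.
have [-> _ _|[i iS]] := set_0Vmem S; first by rewrite cards0.
rewrite (cardsD1 i) iS ltnS => /IH{}IH SD; rewrite -{2}(setD1K iS).
rewrite /= !expnS -!mulnA mulnCA.
apply: leq_trans (leq_mul (leqnn _) (F_le i (S :\ i) _ _)) _.
- exact: (subsetP SD).
- by rewrite !inE eqxx.
by rewrite mulnCA leq_mul2l IH ?orbT // (subset_trans _ SD) // subsetDl.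
Qed.

(* [get] reads and [upd] overwrites one coordinate of a random sample, so that
   the sum over [d] averages over a fresh draw of that coordinate. *)
Section Resample.
Variables (W D : finType) (get : W -> D) (upd : W -> D -> W).
Hypothesis get_upd : forall w d, get (upd w d) = d.
Hypothesis upd_get : forall w, upd w (get w) = w.
Hypothesis upd_upd : forall w d d', upd (upd w d) d' = upd w d'.

Lemma sum_resample (f : W -> nat) :
  \sum_w \sum_d f (upd w d) = #|D| * \sum_w f w.
Proof.
pose swap (p : W * D) := (upd p.1 p.2, get p.1).
have swapK : involutive swap.
  by case=> w d; rewrite /swap /= upd_upd upd_get get_upd.
rewrite pair_bigA (eq_bigr (fun p => f (swap p).1)) //.
rewrite -(reindex_inj (inv_inj swapK) (P := predT) (F := fun p => f p.1)).
rewrite -(pair_bigA _ (fun w _ => f w)) big_distrr.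
by apply: eq_bigr => w _; rewrite sum_nat_const.
Qed.

Lemma leq_sum_resample (f g : W -> nat) a b :
  (forall w, b * \sum_d f (upd w d) <= a * #|D| * g w) ->
  b * \sum_w f w <= a * \sum_w g w.
Proof.
move=> fg; case: (posnP #|D|) => [D0|D_gt0].
  by rewrite big1 ?muln0 // => w _; have := card0_eq D0 (get w).
rewrite -(leq_pmul2l D_gt0) mulnCA -sum_resample mulnA [#|D| * a]mulnC.
by rewrite !big_distrr; apply: leq_sum => w _; apply: fg.
Qed.

Lemma freq_leq_resample (X : Type) (f : W -> X) (Q : X -> pred D) a b :
  (forall w d, f (upd w d) = f w) -> (forall w, freq_leq a b (Q (f w))) ->
  freq_leq a b (fun w => Q (f w) (get w)).
Proof.
move=> f_upd Q_le; rewrite /freq_leq card_set_sum -sum1_card.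
apply: leq_sum_resample => w; rewrite muln1.
under eq_bigr do rewrite f_upd get_upd.
by rewrite -card_set_sum; apply: Q_le.
Qed.

End Resample.

Section Ports.
Variables (n : nat) (port : ports n).
Hypothesis vport : valid_ports port.

Lemma port_inj u : injective (port u).
Proof. by have [] := vport u. Qed.

Lemma port_neq u p : port u p != u.
Proof. by have [_] := vport u. Qed.

Lemma port_surj u v : v != u -> exists p, port u p = v.
Proof.
move=> vu; suff : v \in [set port u p | p : 'I_n.-1].
  by case/imsetP => p _ ->; exists p.
rewrite (_ : [set _ | _ in _] = [set~ u]) ?inE //.
apply/eqP; rewrite eqEcard (card_imset _ (@port_inj u)) cardsC1 !card_ord leqnn.
by rewrite andbT; apply/subsetP => w /imsetP[p _ ->]; rewrite !inE port_neq.
Qed.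

Lemma leq_sum_port u (C : {set 'I_n}) : \sum_p (port u p \in C) <= #|C|.
Proof.
rewrite -card_set_sum -(card_imset _ (@port_inj u)); apply: subset_leq_card.
by apply/subsetP => v /imsetP[p]; rewrite inE => ? ->.
Qed.

Lemma inbox_port m (A : algo n m) (c : config n m A) (B : {set 'I_n}) u v p q :
  port u p = v -> port v q = u ->
  inbox port c B v q = if v \in B then [::] else cout c u p.
Proof.
move=> pv qu; rewrite /inbox qu; case: ifP => // _.
case: pickP => [p' /eqP p'v|/(_ p)]; last by rewrite pv eqxx.
by congr (cout c u _); apply: (@port_inj u); rewrite p'v.
Qed.

End Ports.

Section Execution.
Variables (n m : nat) (A : algo n m).
Variables (port : ports n) (inp : 'I_n -> 'I_m) (adv : adversary A).

Definition config_at (w : coin_space A) t :=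
  last (init_config inp) (configs port inp adv w t).

Definition blocked_at (w : coin_space A) t :=
  adv t (take (maxn 1 t) (configs port inp adv w t)).

Definition first_blocked : {set 'I_n} := adv 0 [:: init_config inp].

Lemma blocked_at0 w : blocked_at w 0 = first_blocked.
Proof. by []. Qed.

Lemma config_atS w t : config_at w t.+1 =
  round port (config_at w t) (blocked_at w t) (coin_at w t).
Proof. by rewrite /config_at /= last_rcons. Qed.

Lemma size_configs w t : size (configs port inp adv w t) = t.+1.
Proof. by elim: t => //= t IH; rewrite size_rcons IH. Qed.

Lemma blocked_atS w t : blocked_at w t.+1 = adv t.+1 (configs port inp adv w t).
Proof.
rewrite /blocked_at (maxn_idPr _) //= -cats1 take_size_cat //.
exact: size_configs.
Qed.

Lemma coin_at_ord (w : coin_space A) (i : 'I_(rounds A)) v :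
  coin_at w i v = w i v.
Proof. by rewrite /coin_at valK. Qed.

Lemma total_msgs_leq (g : nat -> nat) w :
  (forall t, msgs_in (config_at w t.+1) <= g t) ->
  total_msgs port inp adv w <= \sum_(t < rounds A) g t.
Proof.
move=> g_ge; rewrite /total_msgs; elim: (rounds A) => [|t IH].
  by rewrite /= big_seq1 big_ord0 /msgs_in !big1 // => v _; rewrite big1.
rewrite /= -cats1 big_cat big_seq1 big_ord_recr leq_add //=.
by have := g_ge t; rewrite config_atS.
Qed.

Definition set_round (i : 'I_(rounds A)) (w : coin_space A) x : coin_space A :=
  [ffun k => if k == i then x else w k].

Lemma configs_set_round (i : 'I_(rounds A)) w x t : t <= i ->
  configs port inp adv (set_round i w x) t = configs port inp adv w t.
Proof.
elim: t => [|t IH] // ti; rewrite /= IH ?(ltnW ti) //.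
congr (rcons _ (round _ _ _ _)); rewrite /coin_at; case: insubP => // k _ kt.
by rewrite ffunE -val_eqE /= kt ltn_eqF.
Qed.

Lemma config_at_set_round (i : 'I_(rounds A)) w x t :
  t <= i -> config_at (set_round i w x) t = config_at w t.
Proof. by move=> ti; rewrite /config_at configs_set_round. Qed.

(* This is where the lateness of the adversary is used. *)
Lemma blocked_at_set_round (i : 'I_(rounds A)) w x t :
  t <= i.+1 -> blocked_at (set_round i w x) t = blocked_at w t.
Proof. by case: t => // t ti; rewrite !blocked_atS configs_set_round. Qed.

Lemma freq_leq_round (i : 'I_(rounds A)) (X : Type) (f : coin_space A -> X)
    (Q : X -> pred {ffun 'I_n -> Coin A}) a b :
  (forall w x, f (set_round i w x) = f w) ->
  (forall w, freq_leq a b (Q (f w))) ->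
  freq_leq a b (fun w => Q (f w) (w i)).
Proof.
apply: (freq_leq_resample (get := fun w : coin_space A => w i)).
- by move=> w x; rewrite ffunE eqxx.
- by move=> w; apply/ffunP => k; rewrite ffunE; case: eqP => // ->.
- by move=> w x x'; apply/ffunP => k; rewrite !ffunE; case: eqP.
Qed.

End Execution.

Definition deficit g k := if k < g then 4 ^ (g - k) else 0.

Lemma deficitS g k : 4 * deficit g k.+1 <= deficit g k.
Proof.
rewrite /deficit; case: (ltnP k.+1 g) => [kg|]; last by rewrite muln0.
by rewrite (ltnW kg) -expnS subnSK // ltnW.
Qed.

Lemma leq_deficit g k l : k <= l -> deficit g l <= deficit g k.
Proof.
move/subnK <-; elim: (l - k) => // j IH; apply: leq_trans IH.
by rewrite addSn; have := deficitS g (j + k); lia.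
Qed.

Lemma deficit_setU1 (T : finType) (B H : {set T}) v g :
  4 * deficit g #|(v |: H) :\: B| <=
  4 * ((v \in B :|: H :\: B) * deficit g #|H :\: B|) + deficit g #|H :\: B|.
Proof.
rewrite 2!inE; case: (boolP (v \in B)) => vB.
  by rewrite mul1n (leq_trans _ (leq_addr _ _)) ?leq_mul // leq_deficit //
    subset_leq_card // setSD // subsetUr.
case: (boolP (v \in H)) => vH.
  by rewrite (setUidPr _) ?sub1set //= mul1n leq_addr.
rewrite (_ : (v |: H) :\: B = v |: (H :\: B)); last first.
  by apply/setP => u; rewrite !inE; case: eqP => // ->; rewrite vB.
by rewrite cardsU1 !inE (negbTE vH) andbF deficitS.
Qed.

Lemma double_expn_pred d : 0 < d -> 2 * d.-1 ^ d <= d ^ d.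
Proof.
case: d => // a _; rewrite /=.
have bernoulli k : a ^ k.+1 + k.+1 * a ^ k <= a.+1 ^ k.+1.
  elim: k => [|k IH]; first by rewrite !expn1 expn0; lia.
  by rewrite [a.+1 ^ _]expnS; move: IH; rewrite !expnS; nia.
apply: leq_trans (bernoulli a); rewrite mul2n -addnn leq_add2l expnS.
by rewrite leq_mul2r leqnSn orbT.
Qed.

Section Targets.
Variables (n K : nat) (port : ports n).
Hypothesis vport : valid_ports port.

Local Notation draw := {ffun 'I_n -> {ffun 'I_K -> 'I_n.-1}}.
Local Notation slot := ('I_n * 'I_K)%type.
Implicit Types (x : draw) (a : slot) (S : {set slot}) (U B H : {set 'I_n}).

Definition target x a : 'I_n := port a.1 (x a.1 a.2).

Definition hits S x : {set 'I_n} := target x @: S.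

Definition redraw a x p : draw :=
  [ffun u => [ffun j => if (u, j) == a then p else x u j]].

Lemma leq_sum_redraw a (f g : draw -> nat) c d :
  (forall x, d * \sum_p f (redraw a x p) <= c * n.-1 * g x) ->
  d * \sum_x f x <= c * \sum_x g x.
Proof.
move=> fg; pose get x := x a.1 a.2.
apply: (leq_sum_resample (get := get) (upd := redraw a)) => [x p|x|x p p'|x].
- by rewrite /get !ffunE -surjective_pairing eqxx.
- apply/ffunP => u; apply/ffunP => j; rewrite /get !ffunE.
  by case: eqP => // <-.
- apply/ffunP => u; apply/ffunP => j; rewrite /get !ffunE.
  by case: eqP.
by rewrite card_ord; apply: fg.
Qed.

Lemma hits_redraw a S x p : a \notin S ->
  hits (a |: S) (redraw a x p) = port a.1 p |: hits S x.
Proof.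
move=> aS; rewrite /hits imsetU1 {1}/target !ffunE -surjective_pairing eqxx.
congr (_ |: _); apply: eq_in_imset => b bS.
rewrite /target !ffunE -surjective_pairing ifN //.
by apply: contraNneq aS => <-.
Qed.

(* The message leaves the set of fresh nodes unchanged with probability at most
   1/5, and otherwise divides the deficit by 4: a factor 1/5 + 1/4 = 9/20. *)
Lemma sum_deficit_port B H u g : 5 * (#|B| + g) <= n.-1 ->
  20 * \sum_p deficit g #|(port u p |: H) :\: B| <=
  9 * n.-1 * deficit g #|H :\: B|.
Proof.
move=> Bg; have [H_lt|H_geq] := ltnP #|H :\: B| g; last first.
  rewrite big1 ?muln0 // => p _; rewrite /deficit ltnNge (leq_trans H_geq) //.
  by rewrite subset_leq_card // setSD // subsetUr.
have stale : 5 * \sum_p (port u p \in B :|: H :\: B) <= n.-1.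
  apply: leq_trans Bg; rewrite leq_mul2l /=.
  apply: leq_trans (leq_sum_port vport u _) _.
  by apply: leq_trans (leq_card_setU _ _) _; rewrite leq_add2l ltnW.
have : 4 * \sum_p deficit g #|(port u p |: H) :\: B| <=
    4 * ((\sum_p (port u p \in B :|: H :\: B)) * deficit g #|H :\: B|)
    + n.-1 * deficit g #|H :\: B|.
  rewrite -[n.-1 in X in _ <= _ + X * _]card_ord -sum_nat_const.
  rewrite big_distrr big_distrl big_distrr -big_split.
  by apply: leq_sum => p _; apply: deficit_setU1.
nia.
Qed.

Lemma sum_deficit_hits B S g : 5 * (#|B| + g) <= n.-1 ->
  20 ^ #|S| * \sum_x deficit g #|hits S x :\: B| <=
  9 ^ #|S| * (#|{: draw}| * deficit g 0).
Proof.
move=> Bg; pose F S := \sum_x deficit g #|hits S x :\: B|.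
have -> : #|{: draw}| * deficit g 0 = F set0.
  rewrite -sum_nat_const; apply: eq_bigr => x _.
  by rewrite /hits imset0 set0D cards0.
apply: (leq_geometric_set (D := setT) (F := F)) => // a R _ aR.
apply: (leq_sum_redraw (a := a)) => x; under eq_bigr do rewrite hits_redraw //.
exact: sum_deficit_port.
Qed.

Lemma freq_few_hits B S h : 5 * (#|B| + h.*2) <= n.-1 -> 5 * h <= #|S| ->
  freq_leq 1 (2 ^ h) (fun x => #|hits S x :\: B| < h.*2).
Proof.
move=> B_h S_geq; have [->|h_gt0] := posnP h.
  by rewrite /freq_leq !mul1n max_card.
have few : freq_leq (9 ^ #|S| * deficit h.*2 0) (20 ^ #|S|)
    (fun x => #|hits S x :\: B| < h.*2).
  rewrite /freq_leq -mulnA [deficit _ _ * _]mulnC.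
  apply: leq_trans (sum_deficit_hits S B_h); rewrite leq_mul2l.
  apply/orP; right; rewrite card_set_sum; apply: leq_sum => x _.
  by rewrite /deficit; case: ifP => // _; rewrite expn_gt0.
apply: freq_leq_ratio few; first by rewrite expn_gt0.
have -> : deficit h.*2 0 = 16 ^ h.
  by rewrite /deficit double_gt0 h_gt0 subn0 -mul2n expnM.
rewrite mul1n -(subnK S_geq) [9 ^ _]expnD [20 ^ _]expnD !expnM -!mulnA -!expnMn.
(* Five messages multiply the expected deficit by (9/20)^5 < 1/32. *)
apply: leq_mul; last by rewrite (leq_exp2r _ _ h_gt0); lia.
by case: (#|S| - 5 * h) => // r; rewrite leq_exp2r.
Qed.

Lemma freq_miss_geometric v S : {in S, forall a, a.1 != v} ->
  freq_leq (n.-1.-1 ^ #|S|) (n.-1 ^ #|S|) (fun x => v \notin hits S x).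
Proof.
move=> Sv; pose F R := \sum_x (v \notin hits R x).
rewrite /freq_leq card_set_sum.
have <- : F set0 = #|{: draw}|.
  by rewrite -sum1_card; apply: eq_bigr => x _; rewrite /hits imset0 inE.
apply: (leq_geometric_set (D := S) (F := F)) => // a R aS aR.
apply: (leq_sum_redraw (a := a)) => x.
under eq_bigr do rewrite hits_redraw // in_setU1 negb_or.
have [p pv] : exists p, port a.1 p = v.
  by apply: port_surj; rewrite // eq_sym Sv.
rewrite (bigD1 p) //= pv eqxx add0n [n.-1.-1 * _]mulnC -mulnA leq_mul2l.
have -> : n.-1.-1 = #|predC1 p| by rewrite cardC1 card_ord.
rewrite -sum_nat_const; apply/orP; right.
by apply: leq_sum => i _; case: (_ == _).
Qed.

Lemma freq_miss v S q : 0 < n.-1 -> {in S, forall a, a.1 != v} ->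
  n.-1 * q <= #|S| -> freq_leq 1 (2 ^ q) (fun x => v \notin hits S x).
Proof.
move=> n_port Sv S_geq; apply: freq_leq_ratio (freq_miss_geometric Sv).
  by rewrite expn_gt0 n_port.
rewrite mul1n -(subnK S_geq) !expnD !expnM -mulnA -expnMn; apply: leq_mul.
  by case: (#|S| - _) => // r; rewrite leq_exp2r // leq_pred.
by case: q {S_geq} => // q; rewrite leq_exp2r // mulnC double_expn_pred.
Qed.

Definition senders U f : {set slot} :=
  [set a : slot | (a.1 \in U) && (a.2 < f)].

Lemma card_senders U f : f <= K -> #|senders U f| = #|U| * f.
Proof.
move=> fK; have -> : senders U f = setX U [set j : 'I_K | j < f].
  by apply/setP => -[u j]; rewrite !inE.
by rewrite cardsX card_set_ord_lt (minn_idPl fK).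
Qed.

Lemma freq_miss_some U f q : 0 < n.-1 -> f <= K -> n.-1 * q <= #|U|.-1 * f ->
  freq_leq n (2 ^ q) (fun x => [exists v, v \notin hits (senders U f) x]).
Proof.
move=> n_port fK U_geq; have := @freq_leq_exists _ 'I_n
  (fun v x => v \notin hits (senders U f) x) 1 (2 ^ q).
rewrite card_ord muln1; apply=> v.
apply: (@sub_freq_leq _ _ _ _ (fun x => v \notin hits (senders (U :\ v) f) x)).
  move=> x; apply: contra => /imsetP[a].
  rewrite !inE => /andP[/andP[_ aU] af] ->.
  by rewrite imset_f // inE aU.
apply: freq_miss => // [a|]; first by rewrite !inE => /andP[/andP[]].
rewrite card_senders // (leq_trans U_geq) // leq_mul2r (cardsD1 v U).
by case: (v \in U); rewrite ?leqnn ?leq_pred orbT.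
Qed.

End Targets.

Definition least m (s : seq 'I_m) : option 'I_m :=
  [pick y | (y \in s) && all (fun z : 'I_m => y <= z) s].

Lemma least_mem m (s : seq 'I_m) y : least s = Some y -> y \in s.
Proof. by rewrite /least; case: pickP => // z /andP[zs _] [<-]. Qed.

Lemma leastE m (s : seq 'I_m) (y : 'I_m) :
  y \in s -> {in s, forall z : 'I_m, y <= z} -> least s = Some y.
Proof.
move=> ys ymin; rewrite /least; case: pickP => [z /andP[zs /allP zmin]|].
  by congr Some; apply/val_inj/anti_leq; rewrite zmin ?ymin.
by move/(_ y)/negP; case; rewrite ys; apply/allP.
Qed.

Section Gossip.
Variables (n m K T : nat) (fanout : nat -> nat) (p0 : 'I_n.-1).

(* Apart from the initial input, the current value is the least value received
   in the present round: a node keeps no memory of earlier values. *)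
Definition heard (st : nat * option 'I_m) (ib : 'I_n.-1 -> seq 'I_m) :=
  if st.1 == 0 then st.2 else least (flatten [seq ib q | q <- enum 'I_n.-1]).

Definition chosen (x : {ffun 'I_K -> 'I_n.-1}) f : {set 'I_n.-1} :=
  x @: [set j : 'I_K | j < f].

Definition gossip : algo n m :=
  @Algo n m (nat * option 'I_m)%type 'I_m {ffun 'I_K -> 'I_n.-1}
    [ffun=> p0] T.+1 (fun y => (0, Some y))
    (fun st ib x =>
       ((st.1.+1, heard st ib),
        fun p => if p \in chosen x (fanout st.1) then seq_of_opt (heard st ib)
                 else [::]))
    snd.

Variables (port : ports n) (inp : 'I_n -> 'I_m) (adv : adversary gossip).
Hypothesis vport : valid_ports port.

Local Notation config_at := (config_at port inp adv).
Local Notation blocked_at := (blocked_at port inp adv).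

Implicit Types (w : coin_space gossip) (u v : 'I_n) (y : 'I_m).

Definition current w t v :=
  heard (cst (config_at w t) v) (inbox port (config_at w t) (blocked_at w t) v).

Lemma cst_round w t v : (cst (config_at w t) v).1 = t.
Proof. by elim: t => [|t IH] //; rewrite config_atS /= IH. Qed.

Lemma current0 w v : current w 0 v = Some (inp v).
Proof. by []. Qed.

Lemma currentS w t v (c := config_at w t.+1) (B := blocked_at w t.+1) :
  current w t.+1 v =
  least (flatten [seq inbox port c B v q | q <- enum 'I_n.-1]).
Proof. by rewrite /current /heard cst_round. Qed.

Lemma decisionE w v : decision port inp adv w v = current w T v.
Proof. by rewrite /decision /final -/(config_at w _) config_atS. Qed.

Lemma mem_cout w t v p y : (y \in cout (config_at w t.+1) v p) =
  [&& v \notin blocked_at w t, p \in chosen (coin_at w t v) (fanout t)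
    & current w t v == Some y].
Proof.
rewrite config_atS /= cst_round -/(current w t v); case: (v \in _) => //=.
case: (p \in _) => //=; case: (current w t v) => [z|] //=.
by rewrite inE eq_sym.
Qed.

Lemma mem_inbox w t v (c := config_at w t) y :
  reflect (exists u p, [/\ v \notin blocked_at w t, port u p = v
                         & y \in cout c u p])
    (y \in flatten [seq inbox port c (blocked_at w t) v q | q <- enum 'I_n.-1]).
Proof.
apply: (iffP flatten_mapP) => [[q _]|[u [p [vB pv yc]]]].
  rewrite /inbox; case: ifP => // vB; case: pickP => // p /eqP pv yc.
  by exists (port v q), p.
have [q qu] : exists q, port v q = u.
  by apply: port_surj => //; rewrite -pv eq_sym port_neq.
by exists q; rewrite ?mem_enum // (inbox_port _ _ _ pv qu) ?(negbTE vB).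
Qed.

Lemma msgs_in_config_atS w t : msgs_in (config_at w t.+1) <= n * fanout t.
Proof.
rewrite /msgs_in -[n in n * _]card_ord -sum_nat_const; apply: leq_sum => v _.
rewrite config_atS /= cst_round; case: (v \in _); first by rewrite big1.
apply: (@leq_trans (\sum_p (p \in chosen (coin_at w t v) (fanout t)))).
  by apply: leq_sum => p _; case: (p \in _) => //=; case: heard.
rewrite -big_mkcond sum1_card (leq_trans (leq_imset_card _ _)) //.
by rewrite card_set_ord_lt geq_minl.
Qed.

Lemma total_msgs_gossip w :
  total_msgs port inp adv w <= n * \sum_(t < T.+1) fanout t.
Proof.
rewrite big_distrr; apply: (total_msgs_leq (g := fun t => n * fanout t)) => t.
exact: msgs_in_config_atS.
Qed.

Lemma cout_inv (P : pred 'I_m) w t u p y :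
  (forall v, v \notin first_blocked inp adv -> P (inp v)) ->
  y \in cout (config_at w t) u p -> P y.
Proof.
move=> Pinp; elim: t u p y => [|t IH] u p y //.
rewrite mem_cout => /and3P[ub _ /eqP]; case: t IH ub => [_|t IH _].
  by rewrite blocked_at0 current0 => ub [<-]; apply: Pinp.
rewrite currentS => /least_mem /mem_inbox[u' [p' [_ _]]]; exact: IH.
Qed.

Lemma current_inv (P : pred 'I_m) w t v y :
  (forall v, v \notin first_blocked inp adv -> P (inp v)) ->
  current w t.+1 v = Some y -> P y.
Proof.
move=> Pinp; rewrite currentS => /least_mem /mem_inbox[u [p [_ _]]].
exact: cout_inv.
Qed.

Variable best : 'I_m.

Definition informed w t : {set 'I_n} :=
  [set v | (v \notin blocked_at w t) && (current w t v == Some best)].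

Lemma informed_set_round (i : 'I_(rounds gossip)) w x t :
  t <= i -> informed (set_round i w x) t = informed w t.
Proof.
move=> ti; apply/setP => v.
by rewrite !inE /current config_at_set_round // blocked_at_set_round // ltnW.
Qed.

Lemma hits_informed w (i : 'I_(rounds gossip)) :
  (forall v, v \notin first_blocked inp adv -> best <= inp v) ->
  hits port (senders K (informed w i) (fanout i)) (w i) :\: blocked_at w i.+1
    \subset informed w i.+1.
Proof.
move=> best_le; apply/subsetP => v; rewrite 2!inE => /andP[vB /imsetP[[u j]]].
rewrite /target /= !inE /= => /andP[/andP[uB /eqP ub] jf] vE.
rewrite vB; apply/eqP; rewrite currentS; apply: leastE.
  apply/mem_inbox; exists u, (w i u j); split=> //.
  rewrite mem_cout uB ub eqxx andbT /= coin_at_ord.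
  by apply: imset_f; rewrite inE.
move=> z /mem_inbox[u' [p' [_ _]]].
exact: (cout_inv (P := fun z : 'I_m => best <= z)).
Qed.

End Gossip.

Lemma expn2_bounds k : 8 <= k -> 25 * k.+1 <= 2 ^ k /\ k.+4 ^ 2 <= 2 ^ k.
Proof.
move/subnK => <-; elim: (k - 8) => [|j [IH1 IH2]]; first by split.
by rewrite addSn [2 ^ _.+1]expnS; split; nia.
Qed.

Lemma up_log2_bounds n (lg := up_log 2 n) :
  1024 <= n -> 25 * lg <= n /\ lg.+3 ^ 2 <= n.
Proof.
move=> n_ge; have n_gt1 : 1 < n by apply: leq_trans n_ge.
have lg_ge : 10 <= lg by rewrite -(up_expnK 10 (isT : 1 < 2)) leq_up_log.
have lg_lt := up_log_gtn (isT : 1 < 2) n_gt1.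
have [] := @expn2_bounds lg.-1; first by move: lg_ge; lia.
rewrite (ltn_predK lg_ge) => lg25 lg_sqr.
by split; apply: leq_trans (ltnW lg_lt).
Qed.

Lemma exists_least_input n m (inp : 'I_n -> 'I_m) (B : {set 'I_n}) : #|B| < n ->
  exists2 best : 'I_m, forall v, v \notin B -> best <= inp v
    & exists2 v, v \notin B & inp v = best.
Proof.
move=> B_lt; have [v0 v0B] : exists v, v \in ~: B.
  by apply/card_gt0P; rewrite cardsCs setCK card_ord subn_gt0.
rewrite inE in v0B.
case: (@arg_minnP _ v0 (fun v => v \notin B) inp v0B) => v vB v_min.
by exists (inp v) => //; exists v.
Qed.

Section LogGossip.
Variables (n m : nat) (p0 : 'I_n.-1).

Local Notation lg := (up_log 2 n).

Definition burst := 60 * lg.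

Definition fanout t := if 0 < t <= lg then 5 else burst.

Definition log_gossip : algo n m := gossip m burst lg.+2 fanout p0.

Lemma fanout_leq t : fanout t <= burst.
Proof. by rewrite /fanout; case: ifP => // /andP[]; rewrite /burst; lia. Qed.

Lemma sum_fanout : \sum_(t < lg.+3) fanout t = 185 * lg.
Proof.
rewrite big_ord_recl !big_ord_recr /=.
rewrite (eq_bigr (fun=> 5)) => [|t _]; last by rewrite /fanout /bump ltn_ord.
have fanout_late t : lg < t -> fanout t = burst.
  by move=> lg_t; rewrite /fanout [t <= _]leqNgt lg_t andbF.
rewrite sum_nat_const card_ord.
by rewrite !(fanout_late (bump _ _)) /fanout /burst /bump /=; lia.
Qed.

Hypothesis n_ge : 1024 <= n.

Variables (port : ports n) (inp : 'I_n -> 'I_m) (adv : adversary log_gossip).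
Hypothesis vport : valid_ports port.
Hypothesis adv_leq : forall r h, 10 * #|adv r h| <= n.

Local Notation blocked_at := (blocked_at port inp adv).
Local Notation draw := {ffun 'I_n -> {ffun 'I_burst -> 'I_n.-1}}.

Implicit Types (U B : {set 'I_n}) (x : draw) (w : coin_space log_gossip).

(* The initial burst informs [lg] nodes; each round of five messages per node
   then doubles their number, until it is a fixed fraction of [n]. *)
Definition goal t := if t is t'.+1 then minn (lg * 2 ^ t') (n %/ 25) else 1.

Definition stalled t U B x :=
  (goal t <= #|U|) &&
  (#|hits port (senders burst U (fanout t)) x :\: B| < goal t.+1).

Definition uncovered U x :=
  (n %/ 25 <= #|U|) &&
  [exists v, v \notin hits port (senders burst U burst) x].

Lemma goal_geq t : lg <= goal t.+1.
Proof.
rewrite leq_min leq_pmulr ?expn_gt0 // leq_divRL // mulnC.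
by have [] := up_log2_bounds n_ge.
Qed.

Lemma freq_stalled t U B :
  t <= lg -> 10 * #|B| <= n -> freq_leq 1 n (stalled t U B).
Proof.
move=> tl B_leq; apply: freq_leq_andl => U_geq.
pose h := if t is 0 then lg else goal t.
have h_lg : lg <= h by rewrite /h; case: (t) => // t'; apply: goal_geq.
have h_n : h <= n %/ 25.
  rewrite /h; case: (t) => [|t']; last exact: geq_minr.
  exact: leq_trans (goal_geq 0) (geq_minr _ _).
have h_senders : 5 * h <= #|senders burst U (fanout t)|.
  rewrite card_senders ?fanout_leq // /h.
  case: t tl U_geq {h h_lg h_n} => [_|t tl] U_geq.
    by rewrite /fanout /burst /=; move: U_geq => /=; nia.
  by rewrite /fanout /= tl mulnC leq_mul2r U_geq orbT.
have h_goal : goal t.+1 <= h.*2.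
  rewrite /h; case: (t) => [|t'] /=; first by rewrite muln1; lia.
  by rewrite expnS; move: (2 ^ t') => e; lia.
have B_h : 5 * (#|B| + h.*2) <= n.-1 by move: n_ge; lia.
have few := freq_few_hits vport B_h h_senders.
apply: sub_freq_leq (freq_leq_ratio _ _ few) => [x x_few||].
- exact: leq_trans x_few h_goal.
- by rewrite expn_gt0.
by rewrite !mul1n (leq_trans (up_logP n (isT : 1 < 2))) // leq_exp2l.
Qed.

Lemma freq_uncovered U : freq_leq 1 n (uncovered U).
Proof.
apply: freq_leq_andl => U_geq.
have n_port : 0 < n.-1 by move: n_ge; lia.
have q_le : n.-1 * (2 * lg) <= #|U|.-1 * burst.
  have : n.-1 * 2 <= #|U|.-1 * 60 by move: n_ge; lia.
  by rewrite /burst; nia.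
apply: freq_leq_ratio (freq_miss_some vport n_port (leqnn _) q_le).
  by rewrite expn_gt0.
by rewrite mul1n mul2n -addnn expnD leq_mul ?up_logP.
Qed.

Section LeastInput.
Variable best : 'I_m.
Hypothesis best_leq :
  forall v, v \notin first_blocked inp adv -> best <= inp v.
Hypothesis best_inp :
  exists2 v, v \notin first_blocked inp adv & inp v = best.

Local Notation informed := (informed port inp adv best).

Definition failed (i : 'I_(rounds log_gossip)) w :=
  if i <= lg then stalled i (informed w i) (blocked_at w i.+1) (w i)
  else uncovered (informed w i) (w i).

Lemma freq_failed i : freq_leq 1 n (failed i).
Proof.
rewrite /failed; case: leqP => ilg.
  apply: (freq_leq_round (f := fun w => (informed w i, blocked_at w i.+1))
    (Q := fun S => stalled i S.1 S.2)) => [w x|w].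
    by rewrite informed_set_round ?blocked_at_set_round.
  by apply: freq_stalled => //; apply: adv_leq.
apply: (freq_leq_round (f := informed^~ i) (Q := uncovered)) => [w x|w].
  exact: informed_set_round.
exact: freq_uncovered.
Qed.

Lemma goal_leq_informed w t :
  (forall i, ~~ failed i w) -> t <= lg.+1 -> goal t <= #|informed w t|.
Proof.
move=> no_failure; elim: t => [_|t IH tlg].
  have [v vB vE] := best_inp; apply/card_gt0P; exists v.
  by rewrite inE blocked_at0 vB current0 vE /=.
have tT : t < lg.+3 by apply: leq_trans tlg _; rewrite ltnW.
have := no_failure (Ordinal tT); rewrite /failed /= -ltnS tlg /stalled.
rewrite IH ?(ltnW tlg) //=.
rewrite -leqNgt => /leq_trans; apply; apply: subset_leq_card.
exact: (hits_informed vport w (Ordinal tT) best_leq).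
Qed.

Lemma informed_final w :
  (forall i, ~~ failed i w) -> ~: blocked_at w lg.+2 \subset informed w lg.+2.
Proof.
move=> no_failure; have lgT : lg.+1 < lg.+3 by [].
have := no_failure (Ordinal lgT); rewrite /failed /= ltnn /uncovered.
have -> /= : n %/ 25 <= #|informed w lg.+1|.
  apply: leq_trans (goal_leq_informed no_failure (leqnn _)).
  rewrite leq_min leqnn andbT (leq_trans (leq_div _ _)) //.
  apply: leq_trans (up_logP n (isT : 1 < 2)) _.
  by rewrite leq_pmull // up_log_gt0 (leq_trans _ n_ge).
rewrite negb_exists => /forallP covered.
apply/subsetP => v vB.
apply: (subsetP (hits_informed vport w (Ordinal lgT) best_leq)).
move: (covered v) vB; rewrite negbK !inE /fanout /= ltnn.
by move=> -> ->.
Qed.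

Lemma max_agree_geq w : (forall i, ~~ failed i w) ->
  n <= max_agree port inp adv w + #|blocked_at w lg.+2|.
Proof.
move=> no_failure; rewrite -[X in X <= _]card_ord.
rewrite -(cardsC (blocked_at w lg.+2)) addnC.
rewrite leq_add2r (leq_trans (subset_leq_card (informed_final no_failure))) //.
pose F y := #|[set v | decision port inp adv w v == Some y]|.
apply: leq_trans (leq_bigmax (F := F) best).
by apply/subset_leq_card/subsetP => v; rewrite !inE decisionE => /andP[].
Qed.

End LeastInput.

Lemma freq_disagree :
  freq_leq lg.+3 n
    (fun w => ~~ (n <= max_agree port inp adv w + #|blocked_at w lg.+2|)).
Proof.
have [|best best_leq best_inp] := @exists_least_input _ _ inp
  (first_blocked inp adv).
  rewrite /first_blocked; have := adv_leq 0 [:: init_config inp].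
  by move: n_ge; lia.
have := freq_leq_exists (freq_failed best); rewrite card_ord muln1.
apply: sub_freq_leq => w; apply: contraR; rewrite negb_exists.
move=> /forallP no_failure.
exact: (max_agree_geq best_leq best_inp).
Qed.

End LogGossip.

Lemma leq_INR a b : a <= b -> (INR a <= INR b)%R.
Proof. by move/leP; apply: le_INR. Qed.

Lemma INR_gt0 a : 0 < a -> (0 < INR a)%R.
Proof. by move/ltP; apply: lt_0_INR. Qed.

Lemma INR_expn a k : INR (a ^ k) = (INR a ^ k)%R.
Proof. by elim: k => // k IH; rewrite expnS mult_INR IH. Qed.

Lemma up_log2_le_ln n : 1 < n -> (INR (up_log 2 n) <= 4 * ln (INR n))%R.
Proof.
move=> n_gt1; have ln2_gt := ln_lt_2.
have ln_le a b : 0 < a -> a <= b -> (ln (INR a) <= ln (INR b))%R.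
  move=> /INR_gt0 a_gt0 /leq_INR [lt|->]; last exact: Rle_refl.
  by left; apply: ln_increasing.
have ln2_le := ln_le 2 n isT n_gt1.
have : 0 < up_log 2 n by rewrite up_log_gt0.
have := ltnW (up_log_gtn (isT : 1 < 2) n_gt1).
case: (up_log 2 n) => // k /ln_le; rewrite expn_gt0 => /(_ isT) + _.
rewrite INR_expn ln_pow; last exact: INR_gt0.
rewrite succnK [INR k.+1]S_INR; have := pos_INR k; move: ln2_le.
by rewrite (_ : INR 2 = 2%R) //; nra.
Qed.

Lemma ratio_le_Rpower_half q n : 0 < n -> q ^ 2 <= n ->
  (INR q / INR n <= Rpower (INR n) (- / 2))%R.
Proof.
move=> /INR_gt0 n_gt0 /leq_INR; rewrite INR_expn => qn.
have sqrt_gt0 := sqrt_lt_R0 _ n_gt0.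
have q_le : (INR q <= sqrt (INR n))%R.
  by rewrite -(sqrt_pow2 (INR q) (pos_INR q)); apply: sqrt_le_1_alt.
rewrite Rpower_Ropp Rpower_sqrt //; apply: (Rmult_le_reg_r (INR n)) => //.
rewrite -[in X in (_ <= _ * X)%R](sqrt_sqrt _ (Rlt_le _ _ n_gt0)).
by field_simplify; lra.
Qed.

Lemma prob_geq (T : finType) (P : pred T) a b : 0 < b -> 0 < #|T| ->
  freq_leq a b (predC P) -> (1 - INR a / INR b <= prob T P)%R.
Proof.
move=> /INR_gt0 b_gt0 /INR_gt0 T_gt0 /leq_INR; rewrite !mult_INR /prob.
have -> : INR #|[set x | P x]| = (INR #|T| - INR #|[set x | predC P x]|)%R.
  rewrite -(cardsC [set x | P x]) plus_INR (_ : ~: _ = [set x | predC P x]).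
    by rewrite Rplus_minus_r.
  by apply/setP => x; rewrite !inE.
move: (INR #|T|) (INR #|[set x | predC P x]|) T_gt0 => N bad N_gt0 bad_le.
suff : (bad / N <= INR a / INR b)%R.
  by rewrite Rdiv_minus_distr Rdiv_diag; lra.
apply: (Rmult_le_reg_r (INR b * N)); first exact: Rmult_lt_0_compat.
by field_simplify; lra.
Qed.

Definition idle_algo n m : algo n m :=
  @Algo n m unit unit unit tt 0 (fun=> tt) (fun _ _ _ => (tt, fun=> [::]))
    (fun=> None).

Definition gossip_algo (n m : nat) : algo n m :=
  match n with
  | n'.+2 => log_gossip m (ord0 : 'I_n'.+2.-1)
  | n => idle_algo n m
  end.

Section LogGossipReal.
Variables (n m : nat) (p0 : 'I_n.-1).
Hypothesis n_ge : 1024 <= n.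

Let n_gt1 : 1 < n. Proof. exact: leq_trans n_ge. Qed.

Lemma INR_leq_ln q : q <= 185 * up_log 2 n -> (INR q <= 740 * ln (INR n))%R.
Proof.
move/leq_INR; rewrite mult_INR (_ : INR 185 = 185%R); last by rewrite /=; lra.
by have := up_log2_le_ln n_gt1; lra.
Qed.

Lemma rounds_log_gossip :
  (INR (rounds (log_gossip m p0)) <= 740 * ln (INR n))%R.
Proof.
by apply: INR_leq_ln => /=; have := up_log_gt0 2 n; rewrite n_gt1; lia.
Qed.

Variables (port : ports n) (inp : 'I_n -> 'I_m).
Variable adv : adversary (log_gossip m p0).
Hypothesis vport : valid_ports port.

Lemma total_msgs_log_gossip w :
  (INR (total_msgs port inp adv w) <= 740 * INR n * ln (INR n))%R.
Proof.
have /leq_INR : total_msgs port inp adv w <= n * (185 * up_log 2 n).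
  by rewrite -sum_fanout; apply: total_msgs_gossip.
rewrite mult_INR; have := INR_leq_ln (leqnn _).
by have := pos_INR n; nra.
Qed.

Lemma log_gossip_valid y : (forall v, inp v = y) ->
  forall w v z, decision port inp adv w v = Some z -> z = y.
Proof.
move=> inp_y w v z; rewrite decisionE => z_dec.
apply/eqP; apply: (current_inv vport (P := pred1 y)) z_dec => u _.
by rewrite /= inp_y.
Qed.

Lemma prob_log_gossip_agree eps beta :
  (eps <= 1 / 10)%R -> eps_bounded eps adv -> (eps <= beta)%R ->
  (1 - Rpower (INR n) (- / 2) <=
   prob (coin_space (log_gossip m p0))
     (fun w => Rleb ((1 - beta) * INR n) (INR (max_agree port inp adv w))))%R.
Proof.
move=> eps_le adv_eps eps_beta; have n_gt0 := INR_gt0 (ltnW n_gt1).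
have adv_leq r h : 10 * #|adv r h| <= n.
  apply/leP/INR_le; rewrite mult_INR (_ : INR 10 = 10%R).
    by have := adv_eps r h; nra.
  by rewrite /=; lra.
have [_ lg_sqr] := up_log2_bounds n_ge.
apply: Rle_trans (prob_geq (a := (up_log 2 n).+3) (b := n) _ _ _).
- by have := ratio_le_Rpower_half (ltnW n_gt1) lg_sqr; lra.
- exact: ltnW.
- by apply/card_gt0P; exists [ffun=> [ffun=> [ffun=> p0]]].
apply: sub_freq_leq (freq_disagree n_ge inp vport adv_leq) => w.
apply: contra => /leq_INR; rewrite plus_INR /Rleb.
have : (INR #|blocked_at port inp adv w (up_log 2 n).+2| <= eps * INR n)%R.
  exact: adv_eps.
by case: Rle_dec => // agree_lt blocked_le agree_geq; nra.
Qed.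

End LogGossipReal.

Theorem theorem3 :
  forall eps delta : R,
  Rle 0 eps -> Rle eps (Rdiv 1 10) -> Rlt 0 delta -> Rlt delta 1 ->
  forall c : nat,  (* input domain size at most n ^ c *)
  exists (A : forall n m : nat, algo n m) (C a : R) (n0 : nat),
    Rlt 0 a /\
    forall n m : nat, (n0 <= n)%N -> (m <= n ^ c)%N ->
      Rle (INR (rounds (A n m))) (Rmult C (ln (INR n))) /\
      forall (port : ports n) (inp : 'I_n -> 'I_m) (adv : adversary (A n m)),
        valid_ports port -> eps_bounded eps adv ->
        (forall w, Rle (INR (total_msgs port inp adv w))
                       (Rmult (Rmult C (INR n)) (ln (INR n)))) /\
        (forall x : 'I_m, (forall v, inp v = x) ->
           forall w v y, decision port inp adv w v = Some y -> y = x) /\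
        Rle (Rminus 1 (Rpower (INR n) (Ropp a)))
            (prob (coin_space (A n m)) (fun w => Rleb (Rmult (Rminus 1 (Rdiv eps delta)) (INR n))
                                 (INR (max_agree port inp adv w)))).
Proof.
move=> eps delta eps_ge0 eps_le delta_gt0 delta_lt1 c.
have eps_delta : (eps <= eps / delta)%R.
  by apply: (Rmult_le_reg_r delta) => //; field_simplify; nra.
exists gossip_algo, 740%R, (/ 2)%R, 1024; split; first lra.
case=> [|[|n']] // m n_ge _; split; first exact: rounds_log_gossip.
move=> port inp adv vport adv_eps; split; first exact: total_msgs_log_gossip.
split; first exact: log_gossip_valid.
exact: prob_log_gossip_agree adv_eps eps_delta.
Qed.
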